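(* For every integer $n\ge1$, $$\left[-\frac{n-1}{3(n+3)}\frac{1}{(n+1)!},\ \|\operatorname{Re} V^n\|\right]\subset W(\operatorname{Re} V^n)\subset \left[-\|\operatorname{Re} V^n\|,\ \|\operatorname{Re} V^n\|\right]$$ and $$W(\operatorname{Im} V^n)= \left[-\|\operatorname{Im} V^n\|,\ \|\operatorname{Im} V^n\|\right].$$
   Context: $L^2[0,1]$ is the complex Hilbert space of square-integrable functions on $[0,1]$. The Volterra operator $V:L^2[0,1]\to L^2[0,1]$ is defined by $Vf(x):=\int_0^x f(t)\,dt$, and its adjoint is $V^*f(x)=\int_x^1 f(t)\,dt$. For $n\ge1$, write $V^{*n}:=(V^* )^n$, $\operatorname{Re} V^n:=(V^n+V^{*n})/2$ and $\operatorname{Im} V^n:=(V^n-V^{*n})/(2i)$. $\|\cdot\|$ denotes the operator norm on $L^2[0,1]$, and the numerical range of a bounded operator $T$ on $L^2[0,1]$ is $W(T):=\{\langle Tf,f\rangle: f\in L^2[0,1],\ \|f\|_2=1\}$. *)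

(* Defs.v *)
From HB Require Import structures.
From mathcomp Require Import all_boot all_order all_algebra.
From mathcomp Require Import all_classical all_reals all_analysis measurable_realfun.
From mathcomp Require Import ring lra.
From mathcomp Require Import complex.

Set Implicit Arguments.
Unset Strict Implicit.
Unset Printing Implicit Defensive.

Import Order.TTheory GRing.Theory Num.Theory.
Import numFieldNormedType.Exports.

Local Open Scope classical_set_scope.
Local Open Scope ring_scope.
Local Open Scope complex_scope.

Section VolterraOperator.
Variable R : realType.
Implicit Types (f g : R -> R[i]) (T : (R -> R[i]) -> (R -> R[i])).

Local Notation mu := (@lebesgue_measure R).
Local Notation I01 := (`[0 : R, 1 : R]%classic).

(* A vector of L^2[0,1] is given by a representative [f : R -> R[i]], whose
   values outside [0,1] are irrelevant: on [0,1], the inner product, the norm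
   and the operators below depend only on the a.e. class of [f] on [0,1]. *)
Definition L2 : set (R -> R[i]) :=
  [set f : R -> R[i] |
    [/\ measurable_fun I01 (fun x => complex.Re (f x)),
        measurable_fun I01 (fun x => complex.Im (f x)) &
        mu.-integrable I01 (fun x => (complex.Re `|f x| ^+ 2)%:E)]].

Definition Cintegral (D : set R) f : R[i] :=
  (\int[mu]_(x in D) complex.Re (f x)) +i* (\int[mu]_(x in D) complex.Im (f x)).

Definition inner f g : R[i] := Cintegral I01 (fun x => f x * (g x)^*).

Definition L2norm f : R := Num.sqrt (complex.Re (inner f f)).

Definition op_norm T : R :=
  sup [set L2norm (T f) | f in [set f | L2 f /\ L2norm f <= 1]].

Definition num_range T : set R[i] :=
  [set inner (T f) f | f in [set f | L2 f /\ L2norm f = 1]].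

Definition volterra f : R -> R[i] := fun x => Cintegral `[0, x] f.

(* The adjoint is given by its integral formula; see [volterra_adjP] below. *)
Definition volterra_adj f : R -> R[i] := fun x => Cintegral `[x, 1] f.

Definition re_volterra_pow (n : nat) f : R -> R[i] :=
  fun x => (iter n volterra f x + iter n volterra_adj f x) / 2%:R.

Definition im_volterra_pow (n : nat) f : R -> R[i] :=
  fun x => (iter n volterra f x - iter n volterra_adj f x) / (2%:R * 'i%C).

Definition real_segment (a b : R) : set R[i] := [set r%:C | r in `[a, b]].

Let measI : measurable (I01 : set (measurableTypeR R)). Proof. exact: measurable_itv. Qed.

Section kernel.
Variables a c : R -> R.
Hypothesis ia : mu.-integrable I01 (EFin \o a).
Hypothesis ic : mu.-integrable I01 (EFin \o c).

Let RR := measurableTypeR R.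

Let h : RR * RR -> \bar R := fun z =>
  ((c \_ I01) z.1 * (a \_ I01) z.2 * \1_[set z : R * R | z.2 <= z.1] z)%:E.

Let mrestr (u : R -> R) : mu.-integrable I01 (EFin \o u) ->
  measurable_fun (setT : set RR) (u \_ I01).
Proof.
move=> iu; apply: (measurable_restrictT _ measI).1.
have /integrableP[miu _] := iu. apply/measurable_EFinP. exact: miu.
Qed.

Let irestr (u : R -> R) : mu.-integrable I01 (EFin \o u) ->
  mu.-integrable setT (EFin \o (u \_ I01)).
Proof.
move=> iu; rewrite -restrict_EFin.  apply: (integrable_mkcond (mu:=mu) (EFin \o u) measI).1; exact: iu.
Qed.

Let mh : measurable_fun (setT : set (RR * RR)) h.
Proof.
apply/measurable_EFinP; apply: measurable_funM; first apply: measurable_funM.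
- exact: (measurableT_comp (mrestr ic) measurable_fst).
- exact: (measurableT_comp (mrestr ia) measurable_snd).
- apply: measurable_indic.
  have := @measurable_fun_ler _ (RR * RR)%type R setT snd fst measurable_snd measurable_fst.
  move=> /(_ measurableT [set true] I); rewrite setTI; congr measurable.
Qed.


Let mabs (u : R -> R) : mu.-integrable I01 (EFin \o u) ->
  measurable_fun (setT : set (measurableTypeR R))
    (fun y => `|((u \_ I01) y)%:E|%E).
Proof. by move=> iu; have /integrableP[m _] := irestr iu; exact: measurableT_comp m. Qed.

Let ih : (mu \x mu)%E.-integrable setT h.
Proof.
apply/(integrable12ltyP mu mu mh).
have ha : (\int[mu]_y `|((a \_ I01) y)%:E| < +oo)%E by have /integrableP[] := irestr ia.
have hc : (\int[mu]_y `|((c \_ I01) y)%:E| < +oo)%E by have /integrableP[] := irestr ic.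
have ma := mabs ia; have mc := mabs ic.
pose A := (\int[mu]_y `|((a \_ I01) y)%:E|)%E.
have A0 : (0 <= A)%E by exact: integral_ge0.
have mah : measurable_fun (setT : set (RR * RR)) (abse \o h) by exact: measurableT_comp.
apply: (@le_lt_trans _ _ (\int[mu]_x (A * `|((c \_ I01) x)%:E|))%E).
  apply: ge0_le_integral => //.
  - by move=> x _; apply: integral_ge0.
  - by apply: (@measurable_fun_fubini_tonelli_F _ _ RR RR _ mu (abse \o h)) => // z; exact: abse_ge0.
  - exact: (measurable_funeM A mc).
  move=> x _; rewrite muleC -(ge0_integralZl _ _ ma)//.
  apply: ge0_le_integral => //.
  - exact: (measurableT_comp mah (pair1_measurable x)).
  - exact: (measurable_funeM _ ma).
  move=> y _; rewrite /h /= -EFinM lee_fin normrM normrM ler_piMr//.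
  by rewrite indicE; case: (_ \in _); rewrite ?normr1 ?normr0.
rewrite (ge0_integralZl _ _ mc)//.
by apply: lte_mul_pinfty => //; rewrite ge0_fin_numE.
Qed.

Let hE (x y : RR) : \1_[set z : RR * RR | z.2 <= z.1] (x, y) = ((y <= x)%R : nat)%:R :> R.
Proof. by rewrite indicE; congr (nat_of_bool _)%:R; apply/idP/idP; rewrite inE. Qed.

Let FE x : (\int[mu]_y h (x, y))%E =
  ((fun x => c x * \int[mu]_(t in `[0, x]) a t) \_ I01 x)%:E.
Proof.
have [xI|xI] := boolP (x \in I01); last first.
  rewrite /patch (negbTE xI); rewrite integral0_eq// => y _.
  by rewrite /h /patch /= (negbTE xI) !mul0r.
rewrite /patch xI /=.
have x01 : 0 <= x <= 1 by move: xI; rewrite inE /= in_itv.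
have i0x : mu.-integrable `[0, x] (EFin \o a).
  apply: integrableS ia => //; apply: subset_itvl.
  by rewrite bnd_simp; case/andP: x01.
rewrite EFinM /Rintegral fineK; last exact: integrable_fin_num.
rewrite integral_mkcond -integralZl//; last exact: (integrable_mkcond (mu := mu) (EFin \o a) _).1.
apply: eq_integral => y _; rewrite /h /patch /= xI.
rewrite hE !mem_setE /= !in_itv /=.
case/andP: x01 => x0 x1.
have [yx|yx] := leP y x; have [y0|y0] := leP 0 y; rewrite ?mulr0 ?mul0r ?mule0//=.
by rewrite (le_trans yx x1) mulr1.
Qed.

Let GE y : (\int[mu]_x h (x, y))%E =
  ((fun t => a t * \int[mu]_(x in `[t, 1]) c x) \_ I01 y)%:E.
Proof.
have [yI|yI] := boolP (y \in I01); last first.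
  rewrite /patch (negbTE yI); rewrite integral0_eq// => x _.
  by rewrite /h /patch /= (negbTE yI) mulr0 mul0r.
rewrite /patch yI /=.
have y01 : 0 <= y <= 1 by move: yI; rewrite inE /= in_itv.
have i0y : mu.-integrable `[y, 1] (EFin \o c).
  apply: integrableS ic => //; apply: subset_itvr.
  by rewrite bnd_simp; case/andP: y01.
rewrite EFinM /Rintegral fineK; last exact: integrable_fin_num.
rewrite integral_mkcond -integralZl//; last exact: (integrable_mkcond (mu := mu) (EFin \o c) _).1.
apply: eq_integral => x _; rewrite /h /patch /= yI.
rewrite hE !mem_setE /= !in_itv /=.
case/andP: y01 => y0 y1.
have [yx|yx] := leP y x; have [x1|x1] := leP x 1; rewrite ?mulr0 ?mul0r ?mule0//=.
- by rewrite (le_trans y0 yx) mulr1 -EFinM mulrC.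
- by rewrite andbF (_ : point = 0 :> R)// !mul0r.
Qed.

Lemma integrable_primitive :
  mu.-integrable I01 (fun x => (c x * \int[mu]_(t in `[0, x]) a t)%:E).
Proof.
apply/(integrable_mkcond (mu := mu) _ measI).
have := integrable_fubini_F ih; apply: eq_integrable => // x _.
by rewrite /fubini_F FE restrict_EFin.
Qed.

Lemma Rintegral_adj :
  \int[mu]_(x in I01) (c x * \int[mu]_(t in `[0, x]) a t) =
  \int[mu]_(t in I01) (a t * \int[mu]_(x in `[t, 1]) c x).
Proof.
rewrite Rintegral_mkcond [RHS]Rintegral_mkcond /Rintegral; congr fine.
under eq_integral do rewrite -FE.
under [RHS]eq_integral do rewrite -GE.
exact: (Fubini ih).
Qed.
End kernel.

Lemma integrable_coprimitive (a c : R -> R) :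
  mu.-integrable I01 (EFin \o a) -> mu.-integrable I01 (EFin \o c) ->
  mu.-integrable I01 (fun t => (a t * \int[mu]_(x in `[t, 1]) c x)%:E).
Proof.
move=> ia ic.
have := integrableB measI
  (integrableZr measI (\int[mu]_(x in I01) c x) ia) (integrable_primitive ic ia).
apply: eq_integrable => // t; rewrite inE /= in_itv /= => /andP[t0 t1].
rewrite -EFinM -EFinB; congr EFin; rewrite -mulrBr; congr (_ * _).
rewrite Rintegral_itvB ?bnd_simp//; rewrite Rintegral_itv_obnd_cbnd//.
apply: integrableS ic => //; apply: subset_itvr.
by rewrite bnd_simp.
Qed.


Lemma L2_integrable f : L2 f ->
  mu.-integrable I01 (fun x => (complex.Re (f x))%:E) /\
  mu.-integrable I01 (fun x => (complex.Im (f x))%:E).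
Proof.
case=> mRe mIm if2.
have i1 : mu.-integrable I01 (cst 1%:E).
  apply/integrableP; split => //.
  rewrite (eq_integral (cst 1%:E)) => [|x _]; last by rewrite /= normr1.
  by rewrite integral_cst//= mul1e [ltLHS](lebesgue_measure_itv `[0, 1]) /= lte_fin ltr01 -EFinB ltry.
have i2 := integrableD measI i1 if2.
have E x : complex.Re `|f x| ^+ 2 = complex.Re (f x) ^+ 2 + complex.Im (f x) ^+ 2.
  by rewrite normc_def /= sqr_sqrtr// addr_ge0// sqr_ge0.
split; apply: (le_integrable measI _ _ i2) => //; first exact/measurable_EFinP.
- move=> x _ /=; rewrite lee_fin E [leRHS]ger0_norm; last first.
    by rewrite !addr_ge0// sqr_ge0.
  have := sqr_ge0 (complex.Im (f x)); have := sqr_ge0 (`|complex.Re (f x)| - 1).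
  rewrite -[complex.Re (f x) ^+ 2]real_normK ?num_real//; set u := `|_|; nra.
- exact/measurable_EFinP.
- move=> x _ /=; rewrite lee_fin E [leRHS]ger0_norm; last first.
    by rewrite !addr_ge0// sqr_ge0.
  have := sqr_ge0 (complex.Re (f x)); have := sqr_ge0 (`|complex.Im (f x)| - 1).
  rewrite -[complex.Im (f x) ^+ 2]real_normK ?num_real//; set u := `|_|; nra.
Qed.

Let mulcJ (z w : R[i]) : z * w^* =
  (complex.Re w * complex.Re z + complex.Im w * complex.Im z) +i*
  (complex.Re w * complex.Im z - complex.Im w * complex.Re z).
Proof. by case: z w => [a b] [c d] /=; simpc; congr (_ +i* _); ring. Qed.

Lemma volterra_adjP f g : L2 f -> L2 g ->
  inner (volterra f) g = inner f (volterra_adj g).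
Proof.
move=> /L2_integrable[ia ib] /L2_integrable[ic id].
pose a x := complex.Re (f x); pose b x := complex.Im (f x).
pose c x := complex.Re (g x); pose d x := complex.Im (g x).
pose P u x := \int[mu]_(t in `[0, x]) u t : R.
pose Q u t := \int[mu]_(x in `[t, 1]) u x : R.
have PQ u v : mu.-integrable I01 (EFin \o u) -> mu.-integrable I01 (EFin \o v) ->
  \int[mu]_(x in I01) (v x * P u x) = \int[mu]_(t in I01) (u t * Q v t).
  by move=> iu iv; rewrite /P /Q Rintegral_adj.
have iP u v : mu.-integrable I01 (EFin \o u) -> mu.-integrable I01 (EFin \o v) ->
  mu.-integrable I01 (EFin \o (fun x => v x * P u x)).
  exact: integrable_primitive.
have iQ u v : mu.-integrable I01 (EFin \o u) -> mu.-integrable I01 (EFin \o v) ->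
  mu.-integrable I01 (EFin \o (fun x => u x * Q v x)).
  exact: integrable_coprimitive.
have El x : volterra f x * (g x)^* =
    (c x * P a x + d x * P b x) +i* (c x * P b x - d x * P a x).
  by rewrite mulcJ.
have Er x : f x * (volterra_adj g x)^* =
    (a x * Q c x + b x * Q d x) +i* (b x * Q c x - a x * Q d x).
  by rewrite mulcJ /=; congr (_ +i* _); rewrite [LHS]addrC addrC; congr (_ + _);
    rewrite 1?mulrC// mulrC.
rewrite /inner /Cintegral; congr (_ +i* _).
- under eq_Rintegral do rewrite El /=.
  under [RHS]eq_Rintegral do rewrite Er /=.
  rewrite (RintegralD measI (iP _ _ ia ic) (iP _ _ ib id)).
  by rewrite (RintegralD measI (iQ _ _ ia ic) (iQ _ _ ib id)) (PQ _ _ ia ic) (PQ _ _ ib id).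
- under eq_Rintegral do rewrite El /=.
  under [RHS]eq_Rintegral do rewrite Er /=.
  rewrite (RintegralB measI (iP _ _ ib ic) (iP _ _ ia id)).
  by rewrite (RintegralB measI (iQ _ _ ib ic) (iQ _ _ ia id)) (PQ _ _ ib ic) (PQ _ _ ia id).
Qed.

End VolterraOperator.

(* Main.v *)
(* Both operators act on the real and imaginary parts of a function through one
   bounded real operator [A], namely [(V^n + V*^n)/2] or [(V^n - V*^n)/2], with
   transpose [A] or [-A].  [A] maps the unit ball of L^2 to uniformly bounded,
   1/2-Hoelder functions, so by Ascoli it attains its norm at some real unit [g].
   For [Re V^n], self-adjointness and positivity of the kernel turn [g] into a
   unit vector where the quadratic form equals the norm, while the normalized
   [2x - 1] gives the value [-3(n-1)/((n+3)(n+1)!)], below the claimed endpoint.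
   Mixing two real unit vectors [v], [p] as [r v + i s p] yields every convex
   combination of their values.  For [Im V^n], [f = a + i b] has value
   [2 <A b, a>], and taking [b], [a] proportional to [g] and [A g] gives the
   whole segment. *)
Require Import Defs.
From mathcomp Require Import all_boot all_order all_algebra.
From mathcomp Require Import all_classical all_reals all_analysis.
From mathcomp Require Import measurable_realfun ring lra complex.
Import Order.TTheory GRing.Theory Num.Theory.
Import numFieldNormedType.Exports.
Local Open Scope classical_set_scope.
Local Open Scope ring_scope.

Set Implicit Arguments.
Unset Strict Implicit.
Unset Printing Implicit Defensive.

(** * The real space L^2[0,1]: inner product, norm and Cauchy-Schwarz *)

Section RealL2.
Variable R : realType.
Implicit Types (a b d : R -> R) (c x y : R).

Local Notation mu := (@lebesgue_measure R).
Local Notation I01 := (`[0 : R, 1 : R]%classic).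

Lemma measurable_I01 : measurable (I01 : set (measurableTypeR R)).
Proof. exact: measurable_itv. Qed.
Let mI := measurable_I01.

Lemma lebesgue_I01 : mu I01 = 1%:E.
Proof. by rewrite [LHS](lebesgue_measure_itv `[0, 1]) /= lte_fin ltr01 -EFinB subr0. Qed.

Lemma lebesgue_I01_lty : (mu I01 < +oo)%E.
Proof. by rewrite lebesgue_I01 ltry. Qed.

Definition rL2 a := measurable_fun I01 a /\ mu.-integrable I01 (fun x => (a x ^+ 2)%:E).

Definition ip a b : R := \int[mu]_(x in I01) (a x * b x).

Definition nrm a : R := Num.sqrt (ip a a).

Lemma integrable_mul a b : rL2 a -> rL2 b ->
  mu.-integrable I01 (EFin \o (fun x => a x * b x)).
Proof.
move=> [ma ia] [mb ib].
apply: (le_integrable mI _ _ (integrableD mI ia ib)).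
  by apply/measurable_EFinP; exact: measurable_funM.
move=> x _ /=; rewrite lee_fin [leRHS]ger0_norm ?addr_ge0 ?sqr_ge0// normrM.
rewrite -[a x ^+ 2]real_normK ?num_real// -[b x ^+ 2]real_normK ?num_real//.
have := sqr_ge0 (`|a x| - `|b x|); have := mulr_ge0 (normr_ge0 (a x)) (normr_ge0 (b x)).
nra.
Qed.

Lemma rL2_bounded a M : measurable_fun I01 a ->
  (forall x, I01 x -> `|a x| <= M) -> rL2 a.
Proof.
move=> ma aM; split => //.
suff : mu.-integrable I01 (EFin \o (fun x => a x ^+ 2)) by [].
apply: measurable_bounded_integrable => //; first exact: lebesgue_I01_lty.
  exact: measurable_funX.
exists (M ^+ 2); split; first by rewrite num_real.
move=> N MN x Ix /=; rewrite normrX; apply: le_trans (ltW MN).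
by rewrite lerXn2r ?nnegrE//; [apply: le_trans (aM x Ix)|exact: aM].
Qed.

Lemma rL2_cst c : rL2 (cst c).
Proof. exact: (@rL2_bounded _ `|c|). Qed.

Lemma rL2_lin a b c : rL2 a -> rL2 b -> rL2 (fun x => a x + c * b x).
Proof.
move=> ha hb; have [ma ia] := ha; have [mb ib] := hb.
split; first by apply: measurable_funD => //; exact: measurable_funM.
have i1 := integrableD mI (integrableD mI ia (integrableZl mI (2 * c) (integrable_mul ha hb)))
  (integrableZl mI (c ^+ 2) ib).
apply: eq_integrable i1 => // x _.
by rewrite /= -!EFinM -!EFinD; congr EFin; ring.
Qed.

Lemma rL2_scale c a : rL2 a -> rL2 (fun x => c * a x).
Proof.
move=> ha; have := rL2_lin c (rL2_cst 0) ha.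
by congr rL2; apply/funext => x /=; rewrite add0r.
Qed.

Lemma rL2_norm a : rL2 a -> rL2 (fun x => `|a x|).
Proof.
move=> [ma ia]; split; first exact: measurableT_comp.
by apply: eq_integrable ia => // x _; rewrite real_normK ?num_real.
Qed.

Lemma rL2_integrable a : rL2 a -> mu.-integrable I01 (EFin \o a).
Proof.
move=> ha; have := integrable_mul ha (rL2_cst 1).
by apply: eq_integrable => // x _ /=; rewrite mulr1.
Qed.

Lemma ipC a b : ip a b = ip b a.
Proof. by apply: eq_Rintegral => x _; rewrite mulrC. Qed.

Lemma eq_ip a a' b b' : {in I01, a =1 a'} -> {in I01, b =1 b'} -> ip a b = ip a' b'.
Proof. by move=> ea eb; apply: eq_Rintegral => x Ix; rewrite ea ?eb. Qed.

Lemma eq_nrm a a' : {in I01, a =1 a'} -> nrm a = nrm a'.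
Proof. by move=> ea; rewrite /nrm (eq_ip ea ea). Qed.

Lemma ip_linl a b c d : rL2 a -> rL2 b -> rL2 d ->
  ip (fun x => a x + c * b x) d = ip a d + c * ip b d.
Proof.
move=> ha hb hd; rewrite /ip -RintegralZl//; last exact: integrable_mul.
rewrite -RintegralD//; last 2 first.
- exact: integrable_mul.
- exact: (integrableZl mI c (integrable_mul hb hd)).
by apply: eq_Rintegral => x _; ring.
Qed.

Lemma ip_linr a b c d : rL2 a -> rL2 b -> rL2 d ->
  ip d (fun x => a x + c * b x) = ip d a + c * ip d b.
Proof. by move=> ha hb hd; rewrite ipC ip_linl// !(ipC d). Qed.

Lemma ip_scalel c a d : rL2 a -> rL2 d -> ip (fun x => c * a x) d = c * ip a d.
Proof.
move=> ha hd; rewrite /ip -RintegralZl//; last exact: integrable_mul.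
by apply: eq_Rintegral => x _; ring.
Qed.

Lemma ip_ge0 a : 0 <= ip a a.
Proof. by apply: Rintegral_ge0 => x _; rewrite -expr2 sqr_ge0. Qed.

Lemma nrm_ge0 a : 0 <= nrm a. Proof. exact: sqrtr_ge0. Qed.

Lemma sqr_nrm a : nrm a ^+ 2 = ip a a.
Proof. by rewrite sqr_sqrtr// ip_ge0. Qed.

Lemma nrm_norm a : nrm (fun x => `|a x|) = nrm a.
Proof.
by congr Num.sqrt; apply: eq_Rintegral => x _; rewrite -normrM -expr2 ger0_norm ?sqr_ge0.
Qed.

Lemma rL2_opp a : rL2 a -> rL2 (fun x => - a x).
Proof.
by move=> ha; have := rL2_scale (-1) ha; congr rL2; apply/funext => x; rewrite mulN1r.
Qed.

Lemma ip_oppl a b : rL2 a -> rL2 b -> ip (fun x => - a x) b = - ip a b.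
Proof.
by move=> ha hb; rewrite -[RHS]mulN1r -ip_scalel//; apply: eq_ip => // x _; rewrite mulN1r.
Qed.

Lemma nrm_opp a : nrm (fun x => - a x) = nrm a.
Proof. by congr Num.sqrt; apply: eq_Rintegral => x _; rewrite mulrNN. Qed.

Lemma ip_lin_sqr a b c : rL2 a -> rL2 b ->
  ip (fun x => a x + c * b x) (fun x => a x + c * b x) =
  ip a a + 2 * c * ip a b + c ^+ 2 * ip b b.
Proof.
move=> ha hb; have hab := rL2_lin c ha hb.
by rewrite ip_linl// !ip_linr// (ipC b a); ring.
Qed.

Lemma ip_CauchySchwarz a b : rL2 a -> rL2 b -> `|ip a b| <= nrm a * nrm b.
Proof.
move=> ha hb; rewrite -ler_sqr ?nnegrE ?mulr_ge0 ?nrm_ge0//.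
rewrite real_normK ?num_real// exprMn !sqr_nrm.
have [b0|b0] := eqVneq (ip b b) 0.
  have h t := ip_ge0 (fun x => a x + t * b x).
  have {}h t : 0 <= ip a a + 2 * t * ip a b.
    by have := h t; rewrite ip_lin_sqr// b0 mulr0 addr0.
  have [->|ab0] := eqVneq (ip a b) 0; first by rewrite expr0n mulr_ge0// ip_ge0.
  (* With [ip b b = 0] the form is affine in [t]; this [t] gives it the value -1. *)
  have := h (- (ip a a + 1) / (2 * ip a b)).
  rewrite (_ : 2 * _ * _ = - (ip a a + 1)); first by move=> ?; exfalso; lra.
  by field.
have b1 : 0 < ip b b by rewrite lt_neqAle eq_sym b0 ip_ge0.
(* The coefficient of [b] minimizes the quadratic; the minimum is the Gram determinant over
   [ip b b]. *)
have := ip_ge0 (fun x => a x + (- ip a b / ip b b) * b x); rewrite ip_lin_sqr//.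
rewrite (_ : _ + _ = (ip a a * ip b b - ip a b ^+ 2) / ip b b); last by field.
by rewrite pmulr_lge0 ?invr_gt0// subr_ge0.
Qed.

Lemma nrm_scale c a : rL2 a -> nrm (fun x => c * a x) = `|c| * nrm a.
Proof.
move=> ha; have hca := rL2_scale c ha.
rewrite /nrm ip_scalel// ipC ip_scalel// mulrA -expr2.
by rewrite sqrtrM ?sqr_ge0// sqrtr_sqr.
Qed.

Lemma ler_nrmD a b : rL2 a -> rL2 b -> nrm (fun x => a x + b x) <= nrm a + nrm b.
Proof.
move=> ha hb; rewrite -ler_sqr ?nnegrE ?addr_ge0 ?nrm_ge0// sqr_nrm.
have := ip_lin_sqr 1 ha hb.
under eq_fun do rewrite mul1r.
move=> ->; have := le_trans (ler_norm _) (ip_CauchySchwarz ha hb).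
rewrite sqrrD !sqr_nrm; lra.
Qed.

(** [0,1] has measure 1, so a uniform bound is an L^2 bound with the same constant. This turns
    uniform closeness into closeness in norm. *)
Lemma nrm_le_bound a M : measurable_fun I01 a -> 0 <= M ->
  (forall x, I01 x -> `|a x| <= M) -> nrm a <= M.
Proof.
move=> ma M0 aM; have ha := rL2_bounded ma aM.
rewrite -ler_sqr ?nnegrE ?nrm_ge0// sqr_nrm.
have -> : M ^+ 2 = \int[mu]_(x in I01) (M ^+ 2).
  by rewrite Rintegral_cst// [X in fine X]lebesgue_I01 mulr1.
apply: le_Rintegral => //.
- exact: integrable_mul.
- exact: rL2_integrable (rL2_cst (M ^+ 2)).
- move=> x Ix; rewrite -expr2 -real_normK ?num_real//.
  by rewrite lerXn2r ?nnegrE// aM.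
Qed.

Lemma nrm_cst c : nrm (cst c) = `|c|.
Proof.
rewrite /nrm /ip; under eq_Rintegral do rewrite /=.
by rewrite Rintegral_cst// [X in fine X]lebesgue_I01 mulr1 -expr2 sqrtr_sqr.
Qed.

End RealL2.

(** * An Ascoli theorem for 1/2-Hoelder functions on [0,1] *)

Section Ascoli.
Variable R : realType.
Local Notation I01 := (`[0 : R, 1 : R]%classic).

(** The exponent 1/2 is the one that Cauchy-Schwarz gives to primitives of L^2 functions. *)
Definition holder (M : R) (g : R -> R) := forall x y, I01 x -> I01 y ->
  `|g x - g y| <= M * Num.sqrt `|x - y|.

Lemma grid01 (e : R) : 0 < e -> exists (m : nat) (p : 'I_m -> R),
  (forall i, I01 (p i)) /\
  forall x, I01 x -> exists i, Num.sqrt `|x - p i| <= e.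
Proof.
(* The spacing 1/m is at most e^2, as distances enter through their square root. There are m+1 grid
   points, so that x = 1 gets the index m. *)
move=> e0; pose m := (Num.truncn (e ^- 2)).+1.
have m0 : 0 < m%:R :> R by rewrite ltr0n.
have me : m%:R^-1 <= e ^+ 2.
  rewrite -[leRHS]invrK lef_pV2 ?posrE ?invr_gt0 ?exprn_gt0//.
  by apply: ltW; rewrite truncnS_gt.
exists m.+1, (fun i => i%:R / m%:R); split.
  move=> i; rewrite /= in_itv /= divr_ge0// ler_pdivrMr// mul1r ler_nat.
  by rewrite -ltnS ltn_ord.
move=> x; rewrite /= in_itv /= => /andP[x0 x1].
have xm0 : 0 <= x * m%:R by rewrite mulr_ge0// ltW.
have /andP[tx xt] := truncn_itv xm0.
have tm : (Num.truncn (x * m%:R) < m.+1)%N.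
  rewrite ltnS -(@ler_nat R) (le_trans tx)//.
  by rewrite ler_piMl// ltW.
exists (Ordinal tm) => /=.
rewrite -[leRHS](ger0_norm (ltW e0)) -[leRHS]sqrtr_sqr ler_wsqrtr//.
apply: le_trans me.
have -> : x - (Num.truncn (x * m%:R))%:R / m%:R = (x * m%:R - (Num.truncn (x * m%:R))%:R) / m%:R.
  by field; rewrite gt_eqF.
rewrite normrM [X in _ * X]ger0_norm ?invr_ge0 ?(ltW m0)// ler_piMl ?invr_ge0 ?(ltW m0)//.
rewrite ger0_norm ?subr_ge0// lerBlDl; move: xt; rewrite -natr1 => /ltW; lra.
Qed.

(** An ultrafilter finer than [\oo] makes all pointwise limits exist at once, by compactness of
    [-1,1], without a diagonal extraction. The common modulus and a finite grid then make the
    convergence along it uniform. *)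
Lemma holder_ascoli (u : nat -> R -> R) :
  (forall k x, I01 x -> `|u k x| <= 1) -> (forall k, holder 1 (u k)) ->
  exists g, [/\ forall x, I01 x -> `|g x| <= 1, holder 1 g &
    forall e, 0 < e -> forall N, exists2 k, (N <= k)%N &
      forall x, I01 x -> `|u k x - g x| <= e].
Proof.
move=> u1 uh.
have [G [GU ooG]] := @ultraFilterLemma nat \oo _.
have GF : ProperFilter G := @ultra_proper _ _ GU.
have lim x : exists p, I01 x -> `|p| <= 1 /\ ((fun k => u k x) @ G --> p).
  have [Ix|nIx] := pselect (I01 x); last by exists 0.
  have [] := @segment_compact R (-1) 1 ((fun k => u k x) @ G) _.
    by apply: (@filterE nat G) => k /=; rewrite in_itv /= -ler_norml; exact: u1.
  move=> p []; rewrite /= in_itv /= -ler_norml => p1 up; exists p => _; split=> //.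
  apply/cvgrPdist_lt => e e0.
  (* A cluster point of an ultrafilter is a limit: otherwise the indices with [u k x] away from [p]
     form a set of [G], whose image misses [ball p e]. *)
  have [//|GC] := in_ultra_setVsetC [set k | `|p - u k x| < e] GU.
  have [] := up (~` ball p e) (ball p e); last by move=> y [].
    by apply: (@filterS nat G _ _ _ _ GC) => k.
  exact: nbhsx_ballx.
have [g gP] := choice lim.
have nearg x (e : R) : I01 x -> 0 < e -> \forall k \near G, `|u k x - g x| < e.
  move=> Ix e0; have [_ /cvgrPdist_lt /(_ e e0)] := gP x Ix.
  by apply: filterS => k; rewrite distrC.
have gh : holder 1 g.
  move=> x y Ix Iy; apply/ler_addgt0Pr => e e0.
  have e2 : 0 < e / 2 by rewrite divr_gt0.
  have [k [kx ky]] := @filter_ex nat G _ _ (@filterI nat G _ _ _ (nearg x _ Ix e2) (nearg y _ Iy e2)).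
  have := uh k x y Ix Iy; set s := 1 * _ => us.
  have -> : g x - g y = (u k x - u k y) - (u k x - g x) + (u k y - g y) by ring.
  apply: le_trans (ler_normD _ _) _; apply: le_trans (lerD (ler_normB _ _) (lexx _)) _.
  lra.
exists g; split=> // [x /gP[]//|e e0 N].
have e3 : 0 < e / 3 by rewrite divr_gt0.
have [m [p [pI px]]] := grid01 e3.
(* Only finitely many grid points are involved, so one set of [G] serves them all. *)
have nG : \forall k \near G, forall i, `|u k (p i) - g (p i)| < e / 3.
  by apply: filter_forall => i; exact: nearg.
have oG : \forall k \near G, (N <= k)%N by apply: ooG; exact: nbhs_infty_ge.
have [k [/= kp kN]] := @filter_ex nat G _ _ (@filterI nat G _ _ _ nG oG).
exists k => // x Ix; have [i xi] := px x Ix.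
have := uh k x (p i) Ix (pI i); have := gh x (p i) Ix (pI i); have := kp i.
rewrite !mul1r => h1 h2 h3.
have -> : u k x - g x = (u k x - u k (p i)) - (g x - g (p i)) + (u k (p i) - g (p i)) by ring.
apply: le_trans (ler_normD _ _) _; apply: le_trans (lerD (ler_normB _ _) (lexx _)) _.
lra.
Qed.

Lemma holder_measurable M g : holder M g -> measurable_fun I01 g.
Proof.
move=> gh; apply: subspace_continuous_measurable_fun; first exact: measurable_itv.
apply/subspace_continuousP => x Ix; apply/cvgrPdist_le => e e0.
(* [M] may be zero or negative; [M'] is a positive constant above it. *)
pose M' := `|M| + 1.
have M0 : 0 < M' by rewrite ltr_wpDl.
rewrite near_withinE; near=> y => Iy.
apply: le_trans (gh x y Ix Iy) _.
apply: (@le_trans _ _ (M' * Num.sqrt `|x - y|)).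
  rewrite ler_wpM2r ?sqrtr_ge0// (le_trans (ler_norm _))// lerDl ler01//.
have e1 : 0 <= M'^-1 * e by rewrite mulr_ge0 ?invr_ge0 ?ltW.
rewrite -ler_pdivlMl// -[leRHS](ger0_norm e1) -[leRHS]sqrtr_sqr ler_wsqrtr//; near: y.
have d0 : 0 < (M'^-1 * e) ^+ 2 by rewrite exprn_gt0// mulr_gt0// invr_gt0.
by apply: (@cvgr_dist_le _ _ _ _ _ id x) d0; exact: cvg_id.
Unshelve. all: by end_near. Qed.

End Ascoli.

(** * Contractions of L^2 with bounded, 1/2-Hoelder images *)

Section Smoothing.
Variable R : realType.
Local Notation I01 := (`[0 : R, 1 : R]%classic).
Implicit Types a b : R -> R.

(** Shared by V, its adjoint, their positive powers and the signed means of these. Linearity is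
    asked on [0,1] only, since values elsewhere are irrelevant; the constant 1 in both bounds makes
    the class stable under composition. *)
Record smoothing (A : (R -> R) -> (R -> R)) : Prop := Smoothing {
  smoothing_lin : forall a b c, rL2 a -> rL2 b ->
    {in I01, A (fun x => a x + c * b x) =1 (fun x => A a x + c * A b x)};
  smoothing_le : forall a, rL2 a -> forall x, I01 x -> `|A a x| <= nrm a;
  smoothing_holder : forall a, rL2 a -> holder (nrm a) (A a) }.

Section Theory.
Variable A : (R -> R) -> (R -> R).
Hypothesis sA : smoothing A.

Lemma smoothing_rL2 a : rL2 a -> rL2 (A a).
Proof.
move=> ha; apply: rL2_bounded (smoothing_le sA ha).
exact: holder_measurable (smoothing_holder sA ha).
Qed.

Lemma nrm_smoothing a : rL2 a -> nrm (A a) <= nrm a.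
Proof.
move=> ha; apply: nrm_le_bound (nrm_ge0 _) (smoothing_le sA ha).
by have [] := smoothing_rL2 ha.
Qed.

Lemma smoothing_scale c a : rL2 a ->
  {in I01, A (fun x => c * a x) =1 (fun x => c * A a x)}.
Proof.
(* Linearity is used with the zero function as first summand; the pointwise bound forces its image
   to vanish. *)
move=> ha x Ix; have h0 := @rL2_cst R 0.
have := smoothing_lin sA c h0 ha Ix; under eq_fun do rewrite add0r.
move=> ->; have := smoothing_le sA h0 (set_mem Ix).
by rewrite nrm_cst normr0 normr_le0 => /eqP ->; rewrite add0r.
Qed.

Lemma nrm_smoothing_scale c a : rL2 a -> nrm (A (fun x => c * a x)) = `|c| * nrm (A a).
Proof.
by move=> ha; rewrite (eq_nrm (smoothing_scale c ha)) nrm_scale//; exact: smoothing_rL2.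
Qed.

(** The difference has norm zero, and the pointwise bound makes its image vanish on all of [0,1].
    Identities valid only on [0,1] can thus pass through iterates. *)
Lemma eq_smoothing a b : rL2 a -> rL2 b -> {in I01, a =1 b} -> {in I01, A a =1 A b}.
Proof.
move=> ha hb ab x Ix; have hab := rL2_lin (-1) ha hb.
have := smoothing_le sA hab (set_mem Ix); rewrite (smoothing_lin sA)//.
have -> : nrm (fun x => a x + (-1) * b x) = nrm (cst 0 : R -> R).
  by apply: eq_nrm => y Iy /=; rewrite ab// mulN1r subrr.
by rewrite nrm_cst normr0 normr_le0 mulN1r subr_eq0 => /eqP.
Qed.

Lemma smoothing_ip_le l a : rL2 a -> nrm (A a) <= l * nrm a ->
  `|ip (A a) a| <= l * nrm a ^+ 2.
Proof.
move=> ha Al; apply: le_trans (ip_CauchySchwarz (smoothing_rL2 ha) ha) _.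
by rewrite expr2 mulrA ler_wpM2r ?nrm_ge0.
Qed.

(** * Attainment of the norm for operators that are symmetric or skew *)

Section NormAttained.
Variable s : R.
Hypothesis s1 : `|s| = 1.
Hypothesis symA : forall a b, rL2 a -> rL2 b -> ip (A a) b = s * ip a (A b).

Let E := [set nrm (A a) | a in [set a | rL2 a /\ nrm a <= 1]].

Let E_has_sup : has_sup E.
Proof.
split; first by exists (nrm (A (cst 1))), (cst 1) => //; split; [exact: rL2_cst|rewrite nrm_cst normr1].
by exists 1 => _ [a [ha a1] <-]; exact: le_trans (nrm_smoothing ha) a1.
Qed.

Let nrm_le_sup a : rL2 a -> nrm (A a) <= sup E * nrm a.
Proof.
move=> ha; have [a0|a0] := eqVneq (nrm a) 0.
  by have := nrm_smoothing ha; rewrite a0 mulr0.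
have {}a0 : 0 < nrm a by rewrite lt_neqAle eq_sym a0 nrm_ge0.
rewrite -ler_pdivrMr// mulrC -[_^-1]ger0_norm ?invr_ge0 ?nrm_ge0//.
rewrite -nrm_smoothing_scale//.
apply: (sup_upper_bound E_has_sup); eexists; last by reflexivity.
split; first exact: rL2_scale.
by rewrite nrm_scale// ger0_norm ?invr_ge0 ?nrm_ge0// mulVf// gt_eqF.
Qed.

(* Along a maximizing sequence [f k], the functions [u k = A (f k)] satisfy
   [|u k|^2 = |<f k, A (u k)>| <= |A (u k)|], which passes to a uniform limit
   point of [u]. *)
Lemma norm_attained : exists g, [/\ rL2 g, nrm g = 1 &
  forall a, rL2 a -> nrm (A a) <= nrm (A g) * nrm a].
Proof.
have sup0 : 0 <= sup E.
  apply: le_trans (nrm_ge0 (A (cst 0))) _; apply: (sup_upper_bound E_has_sup).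
  by exists (cst 0) => //; split; [exact: rL2_cst|rewrite nrm_cst normr0].
(* If the supremum is 0, every unit vector is a maximizer; the constant 1 is taken. *)
have [l0|l0] := eqVneq (sup E) 0.
  exists (cst 1); split; [exact: rL2_cst|by rewrite nrm_cst normr1|move=> a ha].
  by apply: le_trans (nrm_le_sup ha) _; rewrite l0 mul0r mulr_ge0 ?nrm_ge0.
have {}l0 : 0 < sup E by rewrite lt_neqAle eq_sym l0.
have /choice[f fP] k : exists a, [/\ rL2 a, nrm a <= 1 & sup E - k.+1%:R^-1 < nrm (A a)].
  have k0 : 0 < k.+1%:R^-1 :> R by rewrite invr_gt0.
  by have [_ [a [ha a1] <-] lta] := sup_adherent k0 E_has_sup; exists a.
pose u k := A (f k).
have hu k : rL2 (u k) by apply: smoothing_rL2; have [] := fP k.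
have u1 k x : I01 x -> `|u k x| <= 1.
  by move=> Ix; have [h1 h2 _] := fP k; exact: le_trans (smoothing_le sA h1 Ix) h2.
have uh k : holder 1 (u k).
  move=> x y Ix Iy; have [h1 h2 _] := fP k.
  by apply: le_trans (smoothing_holder sA h1 Ix Iy) _; rewrite ler_wpM2r// sqrtr_ge0.
have [g [g1 gh ug]] := holder_ascoli u1 uh.
have hg : rL2 g by apply: rL2_bounded g1; exact: holder_measurable gh.
(* The index is taken beyond the integer part of 1/e, so that 1/(k+1) <= e as well. *)
have near_g e : 0 < e -> exists k, [/\ sup E - e < nrm (u k), nrm (fun x => u k x + (-1) * g x) <= e &
    nrm (fun x => g x + (-1) * u k x) <= e].
  move=> e0; have [k ke kug] := ug e e0 (Num.truncn e^-1).
  have [_ _ lk] := fP k; exists k; split.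
  - apply: le_lt_trans lk; rewrite lerB// -[leRHS]invrK lef_pV2 ?posrE ?invr_gt0//.
    by apply/ltW; apply: lt_le_trans (truncnS_gt _) _; rewrite ler_nat ltnS.
  - apply: nrm_le_bound; [by have [] := rL2_lin (-1) (hu k) hg|exact: ltW|].
    by move=> x Ix; rewrite mulN1r kug.
  - apply: nrm_le_bound; [by have [] := rL2_lin (-1) hg (hu k)|exact: ltW|].
    by move=> x Ix; rewrite mulN1r distrC kug.
have gl : nrm g <= sup E.
  apply/ler_addgt0Pr => e e0; have [k [_ _ ge]] := near_g e e0.
  have [h1 h2 _] := fP k.
  have ul : nrm (u k) <= sup E.
    by apply: le_trans (nrm_le_sup h1) _; rewrite ler_piMr.
  have := ler_nrmD (hu k) (rL2_lin (-1) hg (hu k)).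
  under eq_fun do rewrite mulN1r subrKC.
  by move=> /le_trans; apply; exact: lerD.
have lAg : sup E ^+ 2 <= nrm (A g).
  apply/ler_addgt0Pr => e e0.
  (* The total error is 4d: as [sup E < nrm (u k) + d] and [nrm (u k) <= 1], [sup E ^+ 2] exceeds
     [nrm (u k) ^+ 2] by at most 3d, and replacing [A (u k)] by [A g] costs one more d. *)
  pose d := Num.min 1 (e / 4).
  have d0 : 0 < d by rewrite lt_min ltr01 divr_gt0.
  have d1 : d <= 1 by rewrite ge_min lexx.
  have de : d <= e / 4 by rewrite ge_min lexx orbT.
  have [k [lu ug' _]] := near_g d d0.
  have [h1 h2 _] := fP k.
  have uA : nrm (u k) ^+ 2 <= nrm (A (u k)).
    rewrite sqr_nrm {1}/u symA// (le_trans (ler_norm _))// normrM s1 mul1r.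
    by apply: le_trans (ip_CauchySchwarz h1 (smoothing_rL2 (hu k))) _; rewrite ler_piMl ?nrm_ge0.
  have Au : nrm (A (u k)) <= nrm (A g) + d.
    have hug := rL2_lin (-1) (hu k) hg.
    have -> : nrm (A (u k)) = nrm (fun x => A g x + A (fun x => u k x + (-1) * g x) x).
      apply: eq_nrm => x Ix; rewrite -[X in _ + X]mul1r -(smoothing_lin sA 1 hg hug Ix).
      by congr (A _ x); apply/funext => y; ring.
    apply: le_trans (ler_nrmD (smoothing_rL2 hg) (smoothing_rL2 hug)) _.
    by rewrite lerD2l (le_trans (nrm_smoothing hug)).
  have ul : nrm (u k) <= 1 by exact: le_trans (nrm_smoothing h1) h2.
  have := nrm_ge0 (u k); nra.
have hg' := rL2_scale (sup E)^-1 hg.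
have g0 : 0 < nrm g.
  have := le_trans lAg (nrm_le_sup hg); rewrite expr2 ler_pM2l//; exact: lt_le_trans.
(* The chain [sup E ^+ 2 <= nrm (A g) <= sup E * nrm g] together with [nrm g <= sup E] forces
   equality, so g divided by [sup E] is a unit maximizer. *)
have gE : nrm g = sup E.
  by apply/le_anti; rewrite gl -(ler_pM2l l0) -expr2 (le_trans lAg)// nrm_le_sup.
exists (fun x => (sup E)^-1 * g x); split => //.
  by rewrite nrm_scale// gE ger0_norm ?invr_ge0// mulVf// gt_eqF.
move=> a ha; apply: le_trans (nrm_le_sup ha) _; rewrite ler_wpM2r ?nrm_ge0//.
by rewrite nrm_smoothing_scale// ger0_norm ?invr_ge0// ler_pdivlMl// -expr2.
Qed.

End NormAttained.

End Theory.

Lemma smoothing_comp A B : smoothing A -> smoothing B -> smoothing (A \o B).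
Proof.
move=> sA sB; split=> [a b c ha hb x Ix|a ha x Ix|a ha x y Ix Iy] /=.
- have hBa := smoothing_rL2 sB ha; have hBb := smoothing_rL2 sB hb.
  rewrite -(smoothing_lin sA)//; apply: (eq_smoothing sA) Ix.
  + by apply: (smoothing_rL2 sB); exact: rL2_lin.
  + exact: rL2_lin.
  + exact: smoothing_lin.
- apply: le_trans (nrm_smoothing sB ha).
  by apply: (smoothing_le sA) => //; exact: (smoothing_rL2 sB).
- apply: le_trans (smoothing_holder sA (smoothing_rL2 sB ha) Ix Iy) _.
  by rewrite ler_wpM2r ?sqrtr_ge0// (nrm_smoothing sB).
Qed.

(** The identity is not smoothing, so the powers start at 1. *)
Lemma smoothing_iter A n : smoothing A -> smoothing (iter n.+1 A).
Proof. by move=> sA; elim: n => // n IH; exact: (smoothing_comp sA IH). Qed.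

(** The factor 1/2 keeps the constants of both bounds at 1. *)
Lemma smoothing_mean A B s : `|s| = 1 -> smoothing A -> smoothing B ->
  smoothing (fun a x => (A a x + s * B a x) / 2).
Proof.
move=> s1 sA sB; split=> [a b c ha hb x Ix|a ha x Ix|a ha x y Ix Iy] /=.
- by rewrite (smoothing_lin sA)// (smoothing_lin sB)//; field.
- rewrite normrM [X in _ * X]ger0_norm// ler_pdivrMr//.
  apply: le_trans (ler_normD _ _) _; rewrite normrM s1 mul1r.
  have := smoothing_le sA ha Ix; have := smoothing_le sB ha Ix; lra.
- rewrite -mulrBl normrM [X in _ * X]ger0_norm// ler_pdivrMr//.
  rewrite (_ : _ - _ = (A a x - A a y) + s * (B a x - B a y)); last by ring.
  apply: le_trans (ler_normD _ _) _; rewrite normrM s1 mul1r.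
  have := smoothing_holder sA ha Ix Iy; have := smoothing_holder sB ha Ix Iy; lra.
Qed.

End Smoothing.

(** * The Volterra operator and its adjoint on real functions *)

Section Primitives.
Variable R : realType.
Local Notation mu := (@lebesgue_measure R).
Local Notation I01 := (`[0 : R, 1 : R]%classic).
Implicit Types a b : R -> R.
Implicit Types x y : R.

Definition prim a x : R := \int[mu]_(t in `[0, x]) a t.
Definition coprim a x : R := \int[mu]_(t in `[x, 1]) a t.

Lemma subset_I01 x y : 0 <= x -> y <= 1 -> `[x, y]%classic `<=` I01.
Proof.
move=> x0 y1 t; rewrite /= !in_itv /= => /andP[xt ty].
by rewrite (le_trans x0 xt) (le_trans ty y1).
Qed.

Lemma integrable_sub a x y : rL2 a -> 0 <= x -> y <= 1 ->
  mu.-integrable `[x, y] (EFin \o a).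
Proof.
move=> ha x0 y1; apply: integrableS (rL2_integrable ha); [| |exact: subset_I01];
  exact: measurable_itv.
Qed.

(** Cauchy-Schwarz against the indicator of [x,y], whose norm is the square root of y - x. *)
Lemma Rintegral_le_nrm a x y : rL2 a -> 0 <= x -> x <= y -> y <= 1 ->
  `|\int[mu]_(t in `[x, y]) a t| <= nrm a * Num.sqrt (y - x).
Proof.
move=> ha x0 xy y1; pose J := `[x, y]%classic : set R.
have mJ : measurable (J : set (measurableTypeR R)) by exact: measurable_itv.
have hJ : rL2 (\1_J : R -> R).
  apply: (@rL2_bounded _ _ 1); first exact: measurable_indic.
  by move=> t _; rewrite indicE; case: (_ \in _); rewrite ?normr1 ?normr0.
have JE (h : R -> R) : \int[mu]_(t in I01) (h t * \1_J t) = \int[mu]_(t in J) h t.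
  have JI : J `<=` I01 := subset_I01 x0 y1.
  rewrite -[in RHS](setIidr JI) [RHS]Rintegral_mkcondr.
  by apply: eq_Rintegral => t _; rewrite /patch indicE; case: (_ \in _); rewrite ?mulr1 ?mulr0.
have := ip_CauchySchwarz ha hJ; rewrite /ip JE => /le_trans; apply.
rewrite /nrm /ip JE; under [X in _ * Num.sqrt X]eq_Rintegral => t tJ do rewrite indicE tJ.
rewrite Rintegral_cst// mul1r [X in fine X](lebesgue_measure_itv `[x, y]) /= lte_fin.
by case: ltP => //= yx; rewrite sqrtr0 mulr0 mulr_ge0 ?sqrtr_ge0.
Qed.

Lemma primB a x y : rL2 a -> 0 <= x -> x <= y -> y <= 1 ->
  prim a y - prim a x = \int[mu]_(t in `[x, y]) a t.
Proof.
move=> ha x0 xy y1; have iy := integrable_sub ha (lexx 0) y1.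
rewrite /prim Rintegral_itvB ?bnd_simp//.
rewrite Rintegral_itv_obnd_cbnd//; apply: integrableS iy => //.
by apply: subset_itvr; rewrite bnd_simp.
Qed.

Lemma prim_coprim a x : rL2 a -> 0 <= x -> x <= 1 ->
  coprim a x = prim a 1 - prim a x.
Proof. by move=> ha x0 x1; rewrite primB. Qed.

Lemma prim_holder a : rL2 a -> holder (nrm a) (prim a).
Proof.
move=> ha x y; rewrite /= !in_itv /= => /andP[x0 x1] /andP[y0 y1].
wlog xy : x y x0 x1 y0 y1 / x <= y.
  by move=> H; have [/H|/ltW/H] := leP x y; [|rewrite distrC (distrC y)]; apply.
by rewrite distrC primB// (distrC x) [`|y - x|]ger0_norm ?subr_ge0//; exact: Rintegral_le_nrm.
Qed.

Lemma smoothing_prim : smoothing prim.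
Proof.
split=> [a b c ha hb x|a ha x|a]; last exact: prim_holder.
- rewrite inE /= in_itv /= => /andP[x0 x1].
  have ia := integrable_sub ha (lexx 0) x1; have ib := integrable_sub hb (lexx 0) x1.
  have mx : measurable (`[0, x] : set (measurableTypeR R)) by exact: measurable_itv.
  rewrite /prim -RintegralZl// -RintegralD//; exact: (integrableZl mx c ib).
- rewrite /= in_itv /= => /andP[x0 x1].
  apply: le_trans (Rintegral_le_nrm ha _ _ _) _ => //.
  by rewrite ler_piMr ?nrm_ge0// -[leRHS]sqrtr1 ler_wsqrtr// subr0.
Qed.

Lemma smoothing_coprim : smoothing coprim.
Proof.
split=> [a b c ha hb x|a ha x|a ha x y].
- rewrite inE /= in_itv /= => /andP[x0 x1].
  have ia := integrable_sub ha x0 (lexx 1); have ib := integrable_sub hb x0 (lexx 1).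
  have mx : measurable (`[x, 1] : set (measurableTypeR R)) by exact: measurable_itv.
  rewrite /coprim -RintegralZl// -RintegralD//; exact: (integrableZl mx c ib).
- rewrite /= in_itv /= => /andP[x0 x1].
  apply: le_trans (Rintegral_le_nrm ha _ _ _) _ => //.
  by rewrite ler_piMr ?nrm_ge0// -[leRHS]sqrtr1 ler_wsqrtr// lerBlDr lerDl.
(* On [0,1], [coprim a] is a constant minus [prim a], hence has the same modulus. *)
- move=> Ix Iy; have := prim_holder ha Ix Iy; move: Ix Iy.
  rewrite /= !in_itv /= => /andP[x0 x1] /andP[y0 y1].
  rewrite !prim_coprim// distrC; congr (`|_| <= _); ring.
Qed.

Lemma rL2_iter_prim a n : rL2 a -> rL2 (iter n prim a).
Proof. by move=> ha; elim: n => // n; exact: smoothing_rL2 smoothing_prim _. Qed.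

Lemma rL2_iter_coprim a n : rL2 a -> rL2 (iter n coprim a).
Proof. by move=> ha; elim: n => // n; exact: smoothing_rL2 smoothing_coprim _. Qed.

(** Fubini over the triangle t <= x, in the form of [Rintegral_adj]. *)
Lemma ip_prim a b : rL2 a -> rL2 b -> ip (prim a) b = ip a (coprim b).
Proof.
by move=> /rL2_integrable ia /rL2_integrable ib; rewrite ipC; exact: Rintegral_adj.
Qed.

Lemma ip_iter_prim a b n : rL2 a -> rL2 b -> ip (iter n prim a) b = ip a (iter n coprim b).
Proof.
move=> ha; elim: n b => // n IH b hb.
rewrite iterS iterSr ip_prim ?IH//; last exact: rL2_iter_prim.
exact: (smoothing_rL2 smoothing_coprim).
Qed.

Lemma ip_iter_coprim a b n : rL2 a -> rL2 b -> ip (iter n coprim a) b = ip a (iter n prim b).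
Proof. by move=> ha hb; rewrite ipC -ip_iter_prim// ipC. Qed.

(** The kernel is nonnegative, so the triangle inequality for integrals carries a pointwise
    domination through each integration. *)
Lemma le_iter_prim a b n : rL2 a -> rL2 b -> (forall x, I01 x -> `|a x| <= b x) ->
  forall x, I01 x -> `|iter n prim a x| <= iter n prim b x.
Proof.
move=> ha hb ab; elim: n => // n IH x; rewrite !iterS /= in_itv /= => /andP[x0 x1].
have hP := rL2_iter_prim n ha.
apply: le_trans (le_normr_Rintegral _ (integrable_sub hP _ x1)) _ => //.
apply: le_Rintegral => //; last by move=> t /(subset_I01 (lexx 0) x1)/IH.
- exact: (integrable_sub (rL2_norm hP)).
- exact: (integrable_sub (rL2_iter_prim n hb)).
Qed.

Lemma le_iter_coprim a b n : rL2 a -> rL2 b -> (forall x, I01 x -> `|a x| <= b x) ->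
  forall x, I01 x -> `|iter n coprim a x| <= iter n coprim b x.
Proof.
move=> ha hb ab; elim: n => // n IH x; rewrite !iterS /= in_itv /= => /andP[x0 x1].
have hP := rL2_iter_coprim n ha.
apply: le_trans (le_normr_Rintegral _ (integrable_sub hP x0 _)) _ => //.
apply: le_Rintegral => //; last by move=> t /(subset_I01 x0 (lexx 1))/IH.
- exact: (integrable_sub (rL2_norm hP)).
- exact: (integrable_sub (rL2_iter_coprim n hb)).
Qed.

(* The cases [s = 1] and [s = -1] give [Re V^n] and [i * Im V^n]. *)
Definition mean_pow (s : R) n a x : R := (iter n prim a x + s * iter n coprim a x) / 2.

Lemma smoothing_mean_pow s n : `|s| = 1 -> smoothing (mean_pow s n.+1).
Proof.
move=> s1; apply: (smoothing_mean s1); apply: smoothing_iter.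
- exact: smoothing_prim.
- exact: smoothing_coprim.
Qed.

Lemma ip_mean_powE s n a b : rL2 a -> rL2 b ->
  ip (mean_pow s n a) b = (ip (iter n prim a) b + s * ip (iter n coprim a) b) / 2.
Proof.
move=> ha hb; have hP := rL2_iter_prim n ha; have hQ := rL2_iter_coprim n ha.
rewrite -ip_linl// mulrC -ip_scalel//; last exact: rL2_lin.
by apply: eq_ip => // x _; rewrite mulrC.
Qed.

(** Transposition exchanges the iterates of [prim] and [coprim], which amounts to a factor [s]
    because s^2 = 1. The operator is thus symmetric for s = 1 and skew for s = -1. *)
Lemma ip_mean_pow s n a b : s ^+ 2 = 1 -> rL2 a -> rL2 b ->
  ip (mean_pow s n a) b = s * ip a (mean_pow s n b).
Proof.
move=> s1 ha hb; rewrite (ipC a) !ip_mean_powE// ip_iter_prim// ip_iter_coprim//.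
by rewrite !(ipC _ a) mulrA mulrDr mulrA -expr2 s1 mul1r addrC.
Qed.

(** For s = 1 both nonnegative kernels enter with a plus sign, so absolute values can only increase
    the form. *)
Lemma ip_mean_pow_norm n a b : rL2 a -> rL2 b ->
  `|ip (mean_pow 1 n a) b| <= ip (mean_pow 1 n (fun x => `|a x|)) (fun x => `|b x|).
Proof.
move=> ha hb; have ha' := rL2_norm ha; have hb' := rL2_norm hb.
have hS c : rL2 c -> rL2 (mean_pow 1 n c).
  move=> hc; have := rL2_scale 2^-1 (rL2_lin 1 (rL2_iter_prim n hc) (rL2_iter_coprim n hc)).
  by congr rL2; apply/funext => x; rewrite mulrC.
apply: le_trans (le_normr_Rintegral (@measurable_I01 R) (integrable_mul (hS _ ha) hb)) _.
under eq_Rintegral do rewrite normrM.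
apply: le_Rintegral; [exact: measurable_I01| | |].
- exact: (integrable_mul (rL2_norm (hS _ ha)) hb').
- by apply: integrable_mul => //; exact: hS.
move=> x Ix; rewrite ler_wpM2r// /mean_pow normrM [X in _ * X]ger0_norm//.
rewrite ler_wpM2r// !mul1r (le_trans (ler_normD _ _))// lerD//.
- exact: le_iter_prim.
- exact: le_iter_coprim.
Qed.

End Primitives.

(** * The quadratic form of [Re V^n] at 2x - 1 *)

Section LinearTestFunction.
Variable R : realType.
Local Notation mu := (@lebesgue_measure R).
Local Notation I01 := (`[0 : R, 1 : R]%classic).

Lemma Rintegral_exprn (x : R) k : 0 <= x ->
  \int[mu]_(t in `[0, x]) t ^+ k = x ^+ k.+1 / k.+1%:R.
Proof.
rewrite le_eqVlt => /predU1P[<-|x0].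
  by rewrite set_itv1 Rintegral_set1 expr0n mul0r.
rewrite /Rintegral (@continuous_FTC2 _ _ (fun t => t ^+ k.+1 / k.+1%:R))//=.
- by rewrite expr0n mul0r subr0.
- by apply: continuous_in_subspaceT => t _; exact: exprn_continuous.
- have cF t : {for t, continuous (fun t : R => t ^+ k.+1 / k.+1%:R)}.
    by apply: cvgM; [exact: exprn_continuous|exact: cvg_cst].
  split.
  + by move=> t _; apply: derivableM => //; exact: exprn_derivable.
  + exact: cvg_at_right_filter (cF 0).
  + exact: cvg_at_left_filter (cF x).
- move=> t _; rewrite derive1Mr//; last exact: exprn_derivable.
  by rewrite derive1E exp_derive scaler1 -mulr_natl mulrAC divff// mul1r.
Qed.

(** This family contains 2x - 1, as [binom2 2 1 (-1) 0], and is stable under [prim] on [0,1], so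
    every iterate has a closed form. *)
Definition binom2 (c : R) i (d : R) j : R -> R := fun x => c * x ^+ i + d * x ^+ j.

Lemma rL2_exprn k : rL2 (fun x : R => x ^+ k).
Proof.
apply: (@rL2_bounded _ _ 1); first exact: exprn_measurable.
move=> x; rewrite /= in_itv /= => /andP[x0 x1].
by rewrite normrX exprn_ile1// ger0_norm.
Qed.

Lemma rL2_binom2 c i d j : rL2 (binom2 c i d j).
Proof. by apply: rL2_lin; [apply: rL2_scale|]; exact: rL2_exprn. Qed.

Lemma ip_exprn i j : ip (fun x : R => x ^+ i) (fun x => x ^+ j) = (i + j).+1%:R^-1.
Proof.
rewrite /ip; under eq_Rintegral do rewrite -exprD.
by rewrite Rintegral_exprn// expr1n mul1r.
Qed.

Lemma ip_binom2 c i d j c' i' d' j' : ip (binom2 c i d j) (binom2 c' i' d' j') =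
  c * c' / (i + i').+1%:R + c * d' / (i + j').+1%:R +
  (d * c' / (j + i').+1%:R + d * d' / (j + j').+1%:R).
Proof.
have h := rL2_exprn; have hs e k := rL2_scale e (h k).
have hb := rL2_binom2 c' i' d' j'.
rewrite {1}/binom2 ip_linl// ip_scalel// /binom2 !ip_linr//.
by rewrite !(ipC _ (fun x => c' * _)) !ip_scalel// !ip_exprn !(addnC i'); ring.
Qed.

Lemma prim_binom2 c i d j : {in I01, prim (binom2 c i d j) =1
  binom2 (c / i.+1%:R) i.+1 (d / j.+1%:R) j.+1}.
Proof.
move=> x xI; have h := rL2_exprn.
have sP := smoothing_prim R.
have /andP[x0 x1] : 0 <= x <= 1 by move: xI; rewrite inE /= in_itv.
rewrite (smoothing_lin sP)//; last exact: rL2_scale.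
rewrite (smoothing_scale sP)// /prim !Rintegral_exprn// /binom2.
by field; rewrite !nat1r !pnatr_eq0.
Qed.

Lemma iter_prim_linear n : {in I01, iter n (@prim R) (binom2 2 1 (-1) 0) =1
  binom2 (2 / n.+1`!%:R) n.+1 (- 1 / n`!%:R) n}.
Proof.
elim: n => [|n IH] x xI; first by rewrite /binom2 /= !divr1.
have sP := smoothing_prim R.
rewrite iterS (eq_smoothing sP _ _ IH)//; last 2 first.
- by apply: rL2_iter_prim; exact: rL2_binom2.
- exact: rL2_binom2.
rewrite prim_binom2// /binom2 (factS n.+1) (factS n) !natrM.
have n0 : 0 <= n%:R :> R by [].
by field; rewrite pnatr_eq0 -lt0n fact_gt0 /=; apply/andP; split; apply/eqP; lra.
Qed.

(** By transposition both halves of the mean contribute the same number, so only the iterated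
    primitive of 2x - 1 has to be computed. *)
Lemma ip_mean_pow_linear n :
  ip (mean_pow 1 n (binom2 2 1 (-1) 0)) (binom2 2 1 (-1) 0) =
  - ((n%:R - 1) / (n%:R + 3) / n.+1`!%:R).
Proof.
have hu := rL2_binom2 2 1 (-1) 0.
rewrite ip_mean_powE// ip_iter_coprim// (ipC _ (iter _ _ _)) mul1r.
rewrite (eq_ip (@iter_prim_linear n) (fun _ _ => erefl)) ip_binom2.
rewrite !addn0 !addn1 factS natrM -!natr1.
have n0 : 0 <= n%:R :> R by [].
by field; rewrite pnatr_eq0 -lt0n fact_gt0 /=; apply/and3P; split; apply/eqP; lra.
Qed.

Lemma ip_linear : ip (binom2 2 1 (-1) 0) (binom2 2 1 (-1) 0) = 3^-1.
Proof. by rewrite ip_binom2 /=; field. Qed.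

(** As 2x - 1 has squared norm 1/3, normalizing it multiplies its value by 3. The result is nine
    times the stated bound, which is at most 0 because n >= 1. *)
Lemma mean_pow_low n : (0 < n)%N -> exists v : R -> R, [/\ rL2 v, nrm v = 1 &
  ip (mean_pow 1 n v) v <= - ((n%:R - 1) / (3 * (n%:R + 3)) * (1 / n.+1`!%:R))].
Proof.
case: n => // n _; have hu := rL2_binom2 2 1 (-1) 0.
set u := binom2 _ _ _ _ in hu; have hv := rL2_scale (Num.sqrt 3) hu.
have s3 : Num.sqrt 3 ^+ 2 = 3 :> R by rewrite sqr_sqrtr.
have sS : smoothing (mean_pow (1 : R) n.+1) by apply: smoothing_mean_pow; rewrite normr1.
exists (fun x => Num.sqrt 3 * u x); split => //.
  rewrite nrm_scale// ger0_norm ?sqrtr_ge0// -sqrtrM//.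
  by rewrite [X in 3 * X]ip_linear mulfV// sqrtr1.
rewrite (eq_ip (smoothing_scale sS _ hu) (fun _ _ => erefl)).
have hS := smoothing_rL2 sS hu.
rewrite ip_scalel// ipC ip_scalel// ipC mulrA -expr2 s3 ip_mean_pow_linear.
rewrite mulrN lerN2 -natr1 addrK.
have n0 : 0 <= n%:R :> R by [].
have f0 : 0 < (n.+2)`!%:R :> R by rewrite ltr0n fact_gt0.
rewrite !mulrA mulr1 ler_wpM2r ?invr_ge0 ?(ltW f0)//.
have D0 : 0 <= (n%:R + 1 + 3)^-1 :> R by rewrite invr_ge0; lra.
by rewrite invfM mulrA ler_wpM2r//; lra.
Qed.

End LinearTestFunction.

(** * From real pairs to complex functions: operator norms and numerical ranges *)

Section ComplexReduction.
Variable R : realType.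
Local Open Scope complex_scope.
Local Notation mu := (@lebesgue_measure R).
Local Notation I01 := (`[0 : R, 1 : R]%classic).
Implicit Types (a b c d : R -> R) (f : R -> R[i]).

Definition cplx a b : R -> R[i] := fun x => a x +i* b x.

Lemma cplx_ReIm f : f = cplx (fun x => complex.Re (f x)) (fun x => complex.Im (f x)).
Proof. by apply/funext => x; rewrite /cplx /=; case: (f x). Qed.

Lemma sqr_normc_Re (z : R[i]) :
  complex.Re `|z| ^+ 2 = complex.Re z ^+ 2 + complex.Im z ^+ 2.
Proof. by rewrite normc_def /= sqr_sqrtr// addr_ge0// sqr_ge0. Qed.

Lemma L2_cplx a b : L2 (cplx a b) <-> rL2 a /\ rL2 b.
Proof.
have mI := @measurable_I01 R.
have E : (fun x => (complex.Re `|cplx a b x| ^+ 2)%:E) = (fun x => (a x ^+ 2 + b x ^+ 2)%:E).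
  by apply/funext => x; rewrite sqr_normc_Re.
split=> [[ma mb +]|[[ma ia] [mb ib]]].
  rewrite E => iab; split; split => //; apply: (le_integrable mI _ _ iab).
  + by apply/measurable_EFinP; exact: measurable_funX.
  + move=> x _; rewrite /= lee_fin !ger0_norm ?addr_ge0 ?sqr_ge0//.
    by rewrite lerDl sqr_ge0.
  + by apply/measurable_EFinP; exact: measurable_funX.
  + move=> x _; rewrite /= lee_fin !ger0_norm ?addr_ge0 ?sqr_ge0//.
    by rewrite lerDr sqr_ge0.
split => //; rewrite E.
exact: (integrableD mI ia ib).
Qed.

Lemma inner_cplx a b c d : rL2 a -> rL2 b -> rL2 c -> rL2 d ->
  inner (cplx a b) (cplx c d) = (ip a c + ip b d) +i* (ip b c - ip a d).
Proof.
move=> ha hb hc hd; have mI := @measurable_I01 R.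
rewrite /inner /Cintegral; congr (_ +i* _).
- rewrite /ip -RintegralD//; try exact: integrable_mul.
  by apply: eq_Rintegral => x _ /=; ring.
- rewrite /ip -RintegralB//; try exact: integrable_mul.
  by apply: eq_Rintegral => x _ /=; ring.
Qed.

Lemma L2norm_cplx a b : rL2 a -> rL2 b -> L2norm (cplx a b) = Num.sqrt (nrm a ^+ 2 + nrm b ^+ 2).
Proof. by move=> ha hb; rewrite /L2norm inner_cplx// !sqr_nrm. Qed.

Lemma iter_volterra n a b : iter n (@volterra R) (cplx a b) = cplx (iter n (@prim R) a) (iter n (@prim R) b).
Proof. by elim: n => // n IH; rewrite !iterS IH. Qed.

Lemma iter_volterra_adj n a b :
  iter n (@volterra_adj R) (cplx a b) = cplx (iter n (@coprim R) a) (iter n (@coprim R) b).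
Proof. by elim: n => // n IH; rewrite !iterS IH. Qed.

Lemma re_volterra_powE n a b :
  re_volterra_pow n (cplx a b) = cplx (mean_pow 1 n a) (mean_pow 1 n b).
Proof.
apply/funext => x; rewrite /re_volterra_pow iter_volterra iter_volterra_adj /cplx /mean_pow !mul1r.
have -> : 2^-1 = (2^-1 : R)%:C :> R[i] by rewrite fmorphV rmorph_nat.
by simpc.
Qed.

(** Division by 2i exchanges real and imaginary parts up to sign. The products with -1 are kept to
    match [mean_pow (-1)]. *)
Lemma divc_2i (p q r t : R) : ((p +i* q) - (r +i* t)) / (2 * 'i%C) =
  ((q + (-1) * t) / 2) +i* (- ((p + (-1) * r) / 2)).
Proof.
have -> : (2 * 'i)^-1 = - (2^-1 : R)%:C * 'i%C :> R[i].
  have I0 : 'i%C != 0 :> R[i] by rewrite eq_complex /= oner_eq0 andbF.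
  rewrite fmorphV rmorph_nat invfM.
  apply: (mulfI I0); rewrite mulrCA divff// mulr1 mulrCA -expr2 sqr_i; ring.
simpc; congr (_ +i* _); ring.
Qed.

Lemma im_volterra_powE n a b :
  im_volterra_pow n (cplx a b) = cplx (mean_pow (-1) n b) (fun x => - mean_pow (-1) n a x).
Proof.
apply/funext => x; rewrite /im_volterra_pow iter_volterra iter_volterra_adj.
exact: divc_2i.
Qed.

(** Squared norms of the two coordinates add, so complex functions do not enlarge the norm, and [g]
    paired with 0 attains it. Only the norm of the image is prescribed, which covers both the
    diagonal action of [Re V^n] and the exchanged coordinates of [Im V^n]. *)
Lemma op_norm_cplx T (A : (R -> R) -> R -> R) g : smoothing A ->
  rL2 g -> nrm g = 1 -> (forall a, rL2 a -> nrm (A a) <= nrm (A g) * nrm a) ->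
  (forall a b, rL2 a -> rL2 b ->
    L2norm (T (cplx a b)) = Num.sqrt (nrm (A a) ^+ 2 + nrm (A b) ^+ 2)) ->
  op_norm T = nrm (A g).
Proof.
move=> sA hg g1 gmax TE; rewrite /op_norm; set E := [set _ | _ in _].
have ubE : ubound E (nrm (A g)).
  move=> _ [f [+ f1] <-]; move: f1; rewrite [f]cplx_ReIm.
  set a := (fun x => complex.Re _); set b := (fun x => complex.Im _) => f1 /L2_cplx[ha hb].
  rewrite TE// -[leRHS]ger0_norm ?nrm_ge0// -sqrtr_sqr ler_wsqrtr//.
  have : nrm a ^+ 2 + nrm b ^+ 2 <= 1.
    move: f1; rewrite L2norm_cplx// -[X in _ <= X]sqrtr1 ler_sqrt//.
  have := gmax a ha; have := gmax b hb.
  rewrite -!(@ler_sqr _ (nrm (A _))) ?nnegrE ?mulr_ge0 ?nrm_ge0// !exprMn.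
  have := sqr_ge0 (nrm (A g)); nra.
have h0 := @rL2_cst R 0.
have EA : E (nrm (A g)).
  exists (cplx g (cst 0)).
    by split; [exact/L2_cplx|rewrite L2norm_cplx// g1 nrm_cst normr0 expr0n expr1n addr0 sqrtr1].
  rewrite TE//; have := nrm_smoothing sA h0; rewrite nrm_cst normr0 => A0.
  have {A0}-> : nrm (A (cst 0)) = 0 by apply/le_anti; rewrite A0 nrm_ge0.
  by rewrite expr0n addr0 sqrtr_sqr ger0_norm ?nrm_ge0.
apply/le_anti/andP; split; first by apply: ge_sup => //; exists (nrm (A g)).
by apply: ub_le_sup => //; exists (nrm (A g)).
Qed.

(** The vector is [A g] normalized. If [A g] has norm 0, any unit vector is orthogonal to it and [g]
    is taken. *)
Lemma dual_vector (A : (R -> R) -> R -> R) g : smoothing A -> rL2 g -> nrm g = 1 ->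
  exists h, [/\ rL2 h, nrm h = 1 & ip (A g) h = nrm (A g)].
Proof.
move=> sA hg g1; have hA := smoothing_rL2 sA hg.
have [l0|l0] := eqVneq (nrm (A g)) 0.
  exists g; split => //; apply/eqP; rewrite l0 -normr_le0.
  by have := ip_CauchySchwarz hA hg; rewrite l0 mul0r.
exists (fun x => (nrm (A g))^-1 * A g x); split; first exact: rL2_scale.
- by rewrite nrm_scale// ger0_norm ?invr_ge0 ?nrm_ge0// mulVf.
- by rewrite ipC ip_scalel// -sqr_nrm expr2 mulKf.
Qed.

Lemma mean_pow_max (s : R) n : s ^+ 2 = 1 -> exists g, [/\ rL2 g, nrm g = 1 &
  forall a, rL2 a -> nrm (mean_pow s n.+1 a) <= nrm (mean_pow s n.+1 g) * nrm a].
Proof.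
move=> s2; have s1 : `|s| = 1.
  by apply/eqP; rewrite -sqrp_eq1// real_normK ?num_real// s2.
by apply: (norm_attained (smoothing_mean_pow n s1) s1) => a b; exact: ip_mean_pow.
Qed.

(** Polarization: the values of the form at g + h and g - h differ by 4l, while the squared norms of
    these vectors add up to 4. As the form is bounded by l times the squared norm, both bounds are
    equalities, and g + h only needs normalizing. *)
Lemma symmetric_top (S : (R -> R) -> R -> R) g h : smoothing S ->
  (forall a b, rL2 a -> rL2 b -> ip (S a) b = ip a (S b)) ->
  rL2 g -> nrm g = 1 -> rL2 h -> nrm h = 1 -> 0 <= ip g h ->
  (forall a, rL2 a -> nrm (S a) <= ip (S g) h * nrm a) ->
  exists p, [/\ rL2 p, nrm p = 1 & ip (S p) p = ip (S g) h].
Proof.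
move=> sS symS hg g1 hh h1 gh0; set l := ip (S g) h => Sl.
have Sle a : rL2 a -> `|ip (S a) a| <= l * nrm a ^+ 2.
  by move=> ha; apply: (smoothing_ip_le sS ha); exact: Sl.
have hSg := smoothing_rL2 sS hg; have hSh := smoothing_rL2 sS hh.
have lin (c : R) : rL2 (fun x => g x + c * h x) by exact: rL2_lin.
have quad (c : R) : ip (S (fun x => g x + c * h x)) (fun x => g x + c * h x) =
    ip (S g) g + 2 * c * l + c ^+ 2 * ip (S h) h.
  rewrite (eq_ip (smoothing_lin sS c hg hh) (fun _ _ => erefl)).
  by rewrite ip_linl// !ip_linr// (symS h)// (ipC h) -/l; ring.
have nrm_quad (c : R) : nrm (fun x => g x + c * h x) ^+ 2 = 1 + 2 * c * ip g h + c ^+ 2.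
  by rewrite sqr_nrm ip_lin_sqr// -!sqr_nrm g1 h1 expr1n mulr1.
pose p x := g x + 1 * h x; have hp : rL2 p := lin 1.
(* The squared norm is 2 + 2 [ip g h]; the sign of [ip g h] keeps g + h away from 0. *)
have p0 : 0 < nrm p.
  by rewrite lt_neqAle nrm_ge0 andbT; apply/eqP => p0; have := nrm_quad 1; rewrite -/p -p0; nra.
have SpE : ip (S p) p = l * nrm p ^+ 2.
  have := Sle _ (lin (-1)); rewrite ler_norml => /andP[+ _].
  have := Sle _ hp; rewrite ler_norml => /andP[_ p2] m1.
  by apply/le_anti; rewrite p2 /=; move: m1; rewrite quad nrm_quad /p quad nrm_quad; lra.
exists (fun x => (nrm p)^-1 * p x); split; first exact: rL2_scale.
- by rewrite nrm_scale// ger0_norm ?invr_ge0 ?nrm_ge0// mulVf// gt_eqF.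
- have hSp := smoothing_rL2 sS hp; have hp' := rL2_scale (nrm p)^-1 hp.
  rewrite (eq_ip (smoothing_scale sS _ hp) (fun _ _ => erefl)).
  by rewrite ip_scalel// ipC ip_scalel// ipC SpE; field; rewrite gt_eqF.
Qed.

(* The kernel of [Re V^n] is nonnegative, so replacing a maximizer [g] and the
   direction [h] of its image by their absolute values loses nothing. *)
Lemma re_mean_pow_top n (g : R -> R) : rL2 g -> nrm g = 1 ->
  (forall a, rL2 a -> nrm (mean_pow 1 n.+1 a) <= nrm (mean_pow 1 n.+1 g) * nrm a) ->
  exists p, [/\ rL2 p, nrm p = 1 & ip (mean_pow 1 n.+1 p) p = nrm (mean_pow 1 n.+1 g)].
Proof.
move=> hg g1 gmax.
have sS : smoothing (mean_pow (1 : R) n.+1) by apply: smoothing_mean_pow; rewrite normr1.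
have [h [hh h1 gh]] := dual_vector sS hg g1.
have hg' := rL2_norm hg; have hh' := rL2_norm hh.
have lE : ip (mean_pow 1 n.+1 (fun x => `|g x|)) (fun x => `|h x|) = nrm (mean_pow 1 n.+1 g).
  apply/le_anti/andP; split.
    apply: le_trans (ler_norm _) _.
    apply: le_trans (ip_CauchySchwarz (smoothing_rL2 sS hg') hh') _.
    by rewrite nrm_norm h1 mulr1; apply: le_trans (gmax _ hg') _; rewrite nrm_norm g1 mulr1.
  by rewrite -gh (le_trans (ler_norm _))// ip_mean_pow_norm.
rewrite -lE in gmax *; apply: (symmetric_top sS) gmax; rewrite ?nrm_norm//.
- by move=> a b ha hb; rewrite ip_mean_pow ?expr1n// mul1r.
- by apply: Rintegral_ge0 => x _; rewrite mulr_ge0.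
Qed.

(** Symmetry cancels the cross terms, so the value is real and has no mixed term in [a] and [b]. *)
Lemma num_range_re n (z : R[i]) : num_range (@re_volterra_pow R n.+1) z <->
  exists a b, [/\ rL2 a, rL2 b, nrm a ^+ 2 + nrm b ^+ 2 = 1 &
    z = (ip (mean_pow 1 n.+1 a) a + ip (mean_pow 1 n.+1 b) b)%:C].
Proof.
have sS : smoothing (mean_pow (1 : R) n.+1) by apply: smoothing_mean_pow; rewrite normr1.
have innerE a b : rL2 a -> rL2 b -> inner (re_volterra_pow n.+1 (cplx a b)) (cplx a b) =
    (ip (mean_pow 1 n.+1 a) a + ip (mean_pow 1 n.+1 b) b)%:C.
  move=> ha hb; have hSa := smoothing_rL2 sS ha; have hSb := smoothing_rL2 sS hb.
  rewrite re_volterra_powE inner_cplx//.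
  by rewrite [ip (mean_pow _ _ b) a]ip_mean_pow ?expr1n// mul1r (ipC b) subrr.
split=> [[f [+ f1] <-]|[a [b [ha hb ab1 ->]]]].
- move: f1; rewrite [f]cplx_ReIm; set a := (fun x => complex.Re _); set b := (fun x => complex.Im _).
  move=> f1 /L2_cplx[ha hb]; exists a, b; split=> //; last exact: innerE.
  by move: f1; rewrite L2norm_cplx// => /(congr1 (fun x => x ^+ 2));
    rewrite sqr_sqrtr ?addr_ge0 ?sqr_ge0// expr1n.
- exists (cplx a b); last exact: innerE.
  by split; [exact/L2_cplx|rewrite L2norm_cplx// ab1 sqrtr1].
Qed.

(** A skew operator sends each vector to an orthogonal one, which kills the imaginary part; the two
    cross terms are equal, whence the factor 2. *)
Lemma num_range_im n (z : R[i]) : num_range (@im_volterra_pow R n.+1) z <->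
  exists a b, [/\ rL2 a, rL2 b, nrm a ^+ 2 + nrm b ^+ 2 = 1 &
    z = (2 * ip (mean_pow (-1) n.+1 b) a)%:C].
Proof.
have sD : smoothing (mean_pow (-1 : R) n.+1).
  by apply: smoothing_mean_pow; rewrite normrN normr1.
have symD a b : rL2 a -> rL2 b ->
    ip (mean_pow (-1) n.+1 a) b = - ip (mean_pow (-1) n.+1 b) a.
  by move=> ha hb; rewrite ip_mean_pow ?sqrrN ?expr1n// mulN1r ipC.
have innerE a b : rL2 a -> rL2 b -> inner (im_volterra_pow n.+1 (cplx a b)) (cplx a b) =
    (2 * ip (mean_pow (-1) n.+1 b) a)%:C.
  move=> ha hb; have hDa := smoothing_rL2 sD ha; have hDb := smoothing_rL2 sD hb.
  have hDa' := rL2_opp hDa.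
  have Z c : rL2 c -> ip (mean_pow (-1) n.+1 c) c = 0.
    by move=> hc; have := symD c c hc hc; lra.
  rewrite im_volterra_powE inner_cplx// !ip_oppl// (symD a b)// !Z// opprK subr0 oppr0.
  by congr (_ +i* _); ring.
split=> [[f [+ f1] <-]|[a [b [ha hb ab1 ->]]]].
- move: f1; rewrite [f]cplx_ReIm; set a := (fun x => complex.Re _); set b := (fun x => complex.Im _).
  move=> f1 /L2_cplx[ha hb]; exists a, b; split=> //; last exact: innerE.
  by move: f1; rewrite L2norm_cplx// => /(congr1 (fun x => x ^+ 2));
    rewrite sqr_sqrtr ?addr_ge0 ?sqr_ge0// expr1n.
- exists (cplx a b); last exact: innerE.
  by split; [exact/L2_cplx|rewrite L2norm_cplx// ab1 sqrtr1].
Qed.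

Lemma op_norm_re n g : rL2 g -> nrm g = 1 ->
  (forall a, rL2 a -> nrm (mean_pow 1 n.+1 a) <= nrm (mean_pow 1 n.+1 g) * nrm a) ->
  op_norm (@re_volterra_pow R n.+1) = nrm (mean_pow 1 n.+1 g).
Proof.
have sS : smoothing (mean_pow (1 : R) n.+1) by apply: smoothing_mean_pow; rewrite normr1.
move=> hg g1 gmax; apply: (op_norm_cplx sS) => // a b ha hb.
rewrite re_volterra_powE L2norm_cplx//; exact: smoothing_rL2.
Qed.

Lemma op_norm_im n g : rL2 g -> nrm g = 1 ->
  (forall a, rL2 a -> nrm (mean_pow (-1) n.+1 a) <= nrm (mean_pow (-1) n.+1 g) * nrm a) ->
  op_norm (@im_volterra_pow R n.+1) = nrm (mean_pow (-1) n.+1 g).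
Proof.
have sD : smoothing (mean_pow (-1 : R) n.+1).
  by apply: smoothing_mean_pow; rewrite normrN normr1.
move=> hg g1 gmax; apply: (op_norm_cplx sD) => // a b ha hb.
have hDa := smoothing_rL2 sD ha; have hDb := smoothing_rL2 sD hb.
have hDa' := rL2_opp hDa.
rewrite im_volterra_powE (L2norm_cplx hDb hDa') nrm_opp.
exact: (congr1 Num.sqrt (addrC _ _)).
Qed.

Lemma num_range_re_le n g : rL2 g -> nrm g = 1 ->
  (forall a, rL2 a -> nrm (mean_pow 1 n.+1 a) <= nrm (mean_pow 1 n.+1 g) * nrm a) ->
  num_range (@re_volterra_pow R n.+1) `<=`
    real_segment (- nrm (mean_pow 1 n.+1 g)) (nrm (mean_pow 1 n.+1 g)).
Proof.
have sS : smoothing (mean_pow (1 : R) n.+1) by apply: smoothing_mean_pow; rewrite normr1.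
move=> hg g1 gmax z /num_range_re[a [b [ha hb ab1 ->]]].
eexists; last by reflexivity.
rewrite /= in_itv /= -ler_norml (le_trans (ler_normD _ _))//.
have Sle c : rL2 c ->
    `|ip (mean_pow 1 n.+1 c) c| <= nrm (mean_pow 1 n.+1 g) * nrm c ^+ 2.
  by move=> hc; apply: (smoothing_ip_le sS hc); exact: gmax.
by apply: le_trans (lerD (Sle _ ha) (Sle _ hb)) _; rewrite -mulrDr ab1 mulr1.
Qed.

(** Without mixed terms, multiples of [v] and [p] placed in the real and imaginary parts average the
    two values, weighted by the squared coefficients, even when [v] and [p] are not orthogonal. *)
Lemma num_range_re_convex n (v p : R -> R) (c : R) : rL2 v -> nrm v = 1 -> rL2 p -> nrm p = 1 ->
  ip (mean_pow 1 n.+1 v) v <= c <= ip (mean_pow 1 n.+1 p) p ->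
  num_range (@re_volterra_pow R n.+1) c%:C.
Proof.
have sS : smoothing (mean_pow (1 : R) n.+1) by apply: smoothing_mean_pow; rewrite normr1.
have Sscale k a : rL2 a -> ip (mean_pow 1 n.+1 (fun x => k * a x)) (fun x => k * a x) =
    k ^+ 2 * ip (mean_pow 1 n.+1 a) a.
  move=> ha; have hSa := smoothing_rL2 sS ha; have hka := rL2_scale k ha.
  rewrite (eq_ip (smoothing_scale sS _ ha) (fun _ _ => erefl)).
  by rewrite ip_scalel// ipC ip_scalel// ipC mulrA expr2.
move=> hv v1 hp p1; set l := ip _ v; set m := ip _ p => /andP[lc cm].
have [t [t0 t1 ->]] : exists t, [/\ 0 <= t, t <= 1 & c = (1 - t) * l + t * m].
  (* If both values agree, [c] equals them and any weight does; 0 is taken. *)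
  have [lm|lm] := eqVneq l m.
    by exists 0; split => //; rewrite subr0 mul1r mul0r addr0; apply/le_anti; rewrite lc lm cm.
  have {}lm : 0 < m - l by rewrite subr_gt0 lt_neqAle lm (le_trans lc).
  exists ((c - l) / (m - l)); split.
  - by rewrite divr_ge0 ?subr_ge0// -subr_ge0 ltW.
  - by rewrite ler_pdivrMr// mul1r lerB.
  - by field; rewrite gt_eqF.
have t2 : 0 <= 1 - t by rewrite subr_ge0.
apply/num_range_re; exists (fun x => Num.sqrt (1 - t) * v x), (fun x => Num.sqrt t * p x).
split; [exact: rL2_scale|exact: rL2_scale| |].
- by rewrite !nrm_scale// v1 p1 !mulr1 !real_normK ?num_real// !sqr_sqrtr// subrK.
- by rewrite (Sscale _ _ hv) (Sscale _ _ hp) !sqr_sqrtr.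
Qed.

Lemma num_range_imE n g : rL2 g -> nrm g = 1 ->
  (forall a, rL2 a -> nrm (mean_pow (-1) n.+1 a) <= nrm (mean_pow (-1) n.+1 g) * nrm a) ->
  num_range (@im_volterra_pow R n.+1) =
    real_segment (- nrm (mean_pow (-1) n.+1 g)) (nrm (mean_pow (-1) n.+1 g)).
Proof.
have sD : smoothing (mean_pow (-1 : R) n.+1).
  by apply: smoothing_mean_pow; rewrite normrN normr1.
move=> hg g1 gmax; set l := nrm (mean_pow _ _ g) in gmax *.
have l0 : 0 <= l by exact: nrm_ge0.
apply/seteqP; split=> z.
  move=> /num_range_im[a [b [ha hb ab1 ->]]]; eexists; last by reflexivity.
  rewrite /= in_itv /= -ler_norml normrM [X in X * _]ger0_norm//.
  have := ip_CauchySchwarz (smoothing_rL2 sD hb) ha; have := gmax b hb.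
  set u := nrm (mean_pow _ _ b); set w := `|_| => ub wu.
  have {wu ub} : w <= l * nrm b * nrm a.
    by apply: le_trans wu _; rewrite ler_wpM2r ?nrm_ge0.
  (* Twice the product of the norms is at most the sum of their squares, which is 1. *)
  have := mulr_ge0 l0 (sqr_ge0 (nrm a - nrm b)).
  have -> : l * (nrm a - nrm b) ^+ 2 = l * (nrm a ^+ 2 + nrm b ^+ 2) - 2 * (l * nrm b * nrm a).
    by ring.
  rewrite ab1; lra.
move=> [c /=]; rewrite in_itv /= => /andP[lc cl] <-.
have [h [hh h1 gh]] := dual_vector sD hg g1.
(* The ratio c / l lies in [-1,1]; when l = 0, also c = 0 and t = 0 serves. *)
have [t [t1 t2 ->]] : exists t, [/\ 0 <= 1 + t, 0 <= 1 - t & c = t * l].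
  have [lz|lz] := eqVneq l 0.
    exists 0; rewrite subr0 addr0 mul0r; split=> //; lra.
  have {}lz : 0 < l by rewrite lt_neqAle eq_sym lz.
  exists (c / l); rewrite divfK ?gt_eqF//; split=> //.
  - by rewrite -(ler_pM2r lz) mul0r mulrDl divfK ?gt_eqF//; lra.
  - by rewrite -(ler_pM2r lz) mul0r mulrBl divfK ?gt_eqF//; lra.
(* [r^2 + s^2 = 1] and [2 r s = t] *)
pose r := (Num.sqrt (1 + t) + Num.sqrt (1 - t)) / 2.
pose s := (Num.sqrt (1 + t) - Num.sqrt (1 - t)) / 2.
have e1 : Num.sqrt (1 + t) ^+ 2 = 1 + t by rewrite sqr_sqrtr.
have e2 : Num.sqrt (1 - t) ^+ 2 = 1 - t by rewrite sqr_sqrtr.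
have hsh := rL2_scale s hh; have hD := smoothing_rL2 sD hg.
(* By [gh], this pair has the value 2 r s l = t l. *)
apply/num_range_im; exists (fun x => s * h x), (fun x => r * g x).
split; [by []|exact: rL2_scale| |].
- rewrite !nrm_scale// g1 h1 !mulr1 !real_normK ?num_real//.
  rewrite (_ : _ + _ = (Num.sqrt (1 + t) ^+ 2 + Num.sqrt (1 - t) ^+ 2) / 2); last by rewrite /r /s; field.
  by rewrite e1 e2; field.
- rewrite (eq_ip (smoothing_scale sD _ hg) (fun _ _ => erefl)).
  rewrite ip_scalel// ipC ip_scalel// ipC gh -/l; congr (_%:C).
  rewrite (_ : 2 * _ = (Num.sqrt (1 + t) ^+ 2 - Num.sqrt (1 - t) ^+ 2) / 2 * l); last by rewrite /r /s; field.
  by rewrite e1 e2; field.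
Qed.

End ComplexReduction.

(** * The numerical ranges in terms of the operator norms *)

Unset Implicit Arguments.

Theorem theorem4p1 (R : realType) (n : nat) (hn : (1 <= n)%N) :
  [/\ real_segment
        (- ((n%:R - 1) / (3 * (n%:R + 3)) * (1 / (n.+1)`!%:R)))
        (op_norm (@re_volterra_pow R n))
        `<=` num_range (@re_volterra_pow R n),
      num_range (@re_volterra_pow R n) `<=`
        real_segment (- op_norm (@re_volterra_pow R n))
                     (op_norm (@re_volterra_pow R n)) &
      num_range (@im_volterra_pow R n) =
        real_segment (- op_norm (@im_volterra_pow R n))
                     (op_norm (@im_volterra_pow R n))].
Proof.
case: n hn => // n _.
have [g [hg g1 gmax]] := @mean_pow_max R 1 n (expr1n _ _).
have [k [hk k1 kmax]] := @mean_pow_max R (-1) n (etrans (sqrrN _) (expr1n _ _)).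
rewrite (op_norm_re hg g1 gmax) (op_norm_im hk k1 kmax).
split; last exact: num_range_imE.
(* The value at [v] is at most the claimed left endpoint and the value at [p] is the norm, so the
   segment lies between them. *)
- have [v [hv v1 vle]] := @mean_pow_low R n.+1 isT.
  have [p [hp p1 pE]] := re_mean_pow_top hg g1 gmax.
  move=> _ [c + <-]; rewrite /= in_itv /= => /andP[lc cl].
  by apply: (num_range_re_convex hv v1 hp p1); rewrite pE cl (le_trans vle).
- exact: num_range_re_le.
Qed.
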